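(* Let $\mathbf{A}\in\mathbb{R}^{n\times n}$ and let $\mathbf{C}\in\mathbb{R}^{p\times n}$ with $\operatorname{rank}\mathbf{C}=p$. There exist real matrices $\mathbf{F}\in\mathbb{R}^{(n-p)\times(n-p)}$, $\mathbf{T}\in\mathbb{R}^{(n-p)\times n}$ and $\mathbf{G}\in\mathbb{R}^{(n-p)\times p}$, with $\mathbf{F}$ Hurwitz stable and $\mathbf{T}$ of full row rank, such that $$\mathbf{T}\mathbf{A}-\mathbf{F}\mathbf{T}=\mathbf{G}\mathbf{C}\qquad\text{and}\qquad \det\begin{bmatrix}\mathbf{C}\\ \mathbf{T}\end{bmatrix}\neq 0,$$ if and only if the pair $(\mathbf{A},\mathbf{C})$ is detectable.
   Context: A real square matrix is Hurwitz stable if all its (complex) eigenvalues have negative real part. For $\mathbf{A}\in\mathbb{R}^{n\times n}$ and $\mathbf{C}\in\mathbb{R}^{p\times n}$, the pair $(\mathbf{A},\mathbf{C})$ is detectable if there exists a real matrix $\mathbf{K}\in\mathbb{R}^{n\times p}$ such that $\mathbf{A}+\mathbf{K}\mathbf{C}$ is Hurwitz stable. The matrix $\begin{bmatrix}\mathbf{C}\\ \mathbf{T}\end{bmatrix}$ is the $n\times n$ matrix obtained by stacking $\mathbf{C}$ on top of $\mathbf{T}$. *)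

(* Defs.v *)
From HB Require Import structures.
From mathcomp Require Import all_boot all_order all_algebra.
From mathcomp Require Import reals complex.

Set Implicit Arguments.
Unset Strict Implicit.
Unset Printing Implicit Defensive.

Import Order.TTheory GRing.Theory Num.Theory.
Local Open Scope ring_scope.
Local Open Scope complex_scope.

(* The eigenvalues range over all of R[i], the matrix being embedded
   entrywise; the library's [eigenvalue] uses row eigenvectors, which for a
   square matrix gives the same eigenvalues as column eigenvectors. *)
Definition hurwitz_stable (R : realType) (n : nat) (A : 'M[R]_n) : Prop :=
  forall z : R[i], eigenvalue (map_mx (real_complex R) A) z -> complex.Re z < 0.

Definition detectable (R : realType) (n p : nat)
    (A : 'M[R]_n) (C : 'M[R]_(p, n)) : Prop :=
  exists K : 'M[R]_(n, p), hurwitz_stable (A + K *m C).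

(* Since nat subtraction is truncated, p + (n - p) = n needs p <= n; this
   follows from the rank hypothesis on C. *)
Lemma full_rank_dim (R : realType) (n p : nat) (C : 'M[R]_(p, n)) :
  \rank C = p -> (p + (n - p) = n)%N.
Proof. by move=> rkC; rewrite subnKC // -{1}rkC rank_leq_col. Qed.

(* [col_mx C T] has p + (n - p) rows; the cast makes it square. *)
Definition stack (R : realType) (n p : nat) (C : 'M[R]_(p, n))
    (rkC : \rank C = p) (T : 'M[R]_(n - p, n)) : 'M[R]_n :=
  castmx (full_rank_dim rkC, erefl n) (col_mx C T).

(* Main.v *)
Require Import Defs.
From mathcomp Require Import all_boot all_order all_algebra.
From mathcomp Require Import reals complex.
From mathcomp Require Import ring.

(** Why the theorem is true.

    Complete C to an invertible matrix S = [C; T0] and pass to the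
    coordinates given by S, in which A becomes a block matrix
    B = [B11 B12; B21 B22] and C becomes [1 0].  Output injection then changes
    the first block column of B at will and leaves the second one alone.

    From an observer to detectability ([observer_detectable]): take S = [C; T].
    The equation TA = FT + GC says that the lower block row of B is [G F].
    Injecting so as to replace the first block column by [-1; 0] leaves an
    upper block triangular matrix with the stable diagonal blocks -1 and F.

    From detectability to an observer ([detectable_observer]): some matrix M
    with second block column [B12; B22] is stable, and the matrix
    T = [L 1] S solves the equation with F = B22 + L B12, so all that is needed
    is a gain L that makes F stable.  It is read off a Lyapunov matrix:
    if P is symmetric positive definite and P M has a negative definite
    quadratic form, then so does the lower right block of P M, which is
    P21 B12 + P22 B22 = P22 (B22 + P22^-1 P21 B12).  Hence P22 is a Lyapunov
    matrix for F with L = P22^-1 P21 ([lyapunov_corner]).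

    What remains is Lyapunov's theorem itself.  A complex stable matrix is
    unitarily triangularizable, and for a triangular matrix with stable
    diagonal a diagonal P works, its weights being chosen one after the other
    so that each new diagonal term dominates the mixed terms that come with it
    ([trig_lyapunov]).  For a real matrix the real part of the complex P is
    again a Lyapunov matrix ([hurwitz_lyapunov]).  Conversely a Lyapunov matrix
    forces stability by evaluating the form at an eigenvector
    ([lyapunov_hurwitz]). *)

Import Order.TTheory GRing.Theory Num.Theory.
Local Open Scope ring_scope.
Local Open Scope sesquilinear_scope.
Set Implicit Arguments.
Unset Strict Implicit.

(** * Hermitian forms and Lyapunov matrices over a closed field *)

Section Entry.
Context {K : pzRingType}.
Implicit Types A B : 'M[K]_1.

Lemma mulmx11 A B : (A *m B) 0 0 = A 0 0 * B 0 0.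
Proof. by rewrite mxE big_ord1. Qed.

Lemma entryD A B : (A + B) 0 0 = A 0 0 + B 0 0.
Proof. by rewrite mxE. Qed.

Lemma entryN A : (- A) 0 0 = - A 0 0.
Proof. by rewrite mxE. Qed.

End Entry.

Section ComplexLyapunov.
Context {C : numClosedFieldType}.

Lemma adjoint_mulmx m n p (A : 'M[C]_(m, n)) (B : 'M[C]_(n, p)) :
  (A *m B)^t* = B^t* *m A^t*.
Proof. by rewrite trmx_mul map_mxM. Qed.

Lemma entryJ (A : 'M[C]_1) : (A^t*) 0 0 = (A 0 0)^*.
Proof. by rewrite !mxE. Qed.

Lemma diag_form_gt0 n (d z : 'rV[C]_n) :
  (forall i, 0 < d 0 i) -> z != 0 -> 0 < (z *m diag_mx d *m z^t*) 0 0.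
Proof.
move=> d_gt0 /rV0Pn[k zk].
have -> : (z *m diag_mx d *m z^t*) 0 0 = \sum_i d 0 i * (z 0 i * (z 0 i)^*).
  rewrite mxE; apply: eq_bigr => i _.
  by rewrite mul_mx_diag !mxE mulrAC mulrC.
rewrite (bigD1 k) //= ltr_pwDl //.
  by rewrite mulr_gt0 // mul_conjC_gt0.
by apply: sumr_ge0 => i _; rewrite mulr_ge0 ?mul_conjC_ge0 ?ltW.
Qed.

Lemma normmx_gt0 n (z : 'rV[C]_n) : z != 0 -> 0 < (z *m z^t*) 0 0.
Proof.
move=> z0; have := @diag_form_gt0 n (const_mx 1) z _ z0.
by rewrite diag_const_mx mulmx1; apply=> i; rewrite mxE ltr01.
Qed.

Lemma normmx_ge0 n (z : 'rV[C]_n) : 0 <= (z *m z^t*) 0 0.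
Proof.
have [->|/normmx_gt0/ltW//] := eqVneq z 0.
by rewrite mul0mx mxE.
Qed.

(** Induction on the size, from the last block upwards.  Requiring minus the
    squared norm as an upper bound, rather than mere negativity, gives the
    induction the slack it needs: doubling the weights of the smaller block
    leaves one spare copy of its squared norm, and that copy absorbs the mixed
    terms. *)
Lemma trig_lyapunov n (T : 'M[C]_n) :
    is_trig_mx T -> (forall i, T i i + (T i i)^* < 0) ->
  exists2 d : 'rV[C]_n, (forall i, 0 < d 0 i) &
    forall z : 'rV_n, let q := (z *m diag_mx d *m T *m z^t*) 0 0 in
      q + q^* + (z *m z^t*) 0 0 <= 0.
Proof.
move=> T_trig; elim/trigsqmx_ind: n T / T_trig => [|n x c A _ IHA] T_lt0.
  exists 0 => [[]//|z /=].
  by rewrite !thinmx0 !mul0mx !mxE conjC0 !addr0.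
have [d d_gt0 dA] : exists2 d : 'rV[C]_n, (forall i, 0 < d 0 i) &
    forall z : 'rV_n, let q := (z *m diag_mx d *m A *m z^t*) 0 0 in
      q + q^* + (z *m z^t*) 0 0 <= 0.
  by apply: IHA => i; have := T_lt0 (rshift 1 i); rewrite block_mxEdr.
have x_lt0 : x 0 0 + (x 0 0)^* < 0.
  by have := T_lt0 (lshift n 0); rewrite block_mxEul.
(* With z = [a b], the mixed term is (b u) a^*.  Completing a square bounds it,
   up to K times the squared norm of a; the weight t of a is the one that pays
   for this and for the squared norm of a itself. *)
pose u := diag_mx (2%:R *: d) *m c.
pose K := (u^t* *m u) 0 0.
have K_ge0 : 0 <= K by have := normmx_ge0 (u^t*); rewrite trmxCK.
pose t := - (1 + K) / (x 0 0 + (x 0 0)^*).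
have t_gt0 : 0 < t.
  by rewrite /t mulNr -mulrN -invrN divr_gt0 ?oppr_gt0 // ltr_wpDr.
exists (row_mx t%:M (2%:R *: d)) => [i|z /=].
  rewrite mxE; case: splitP => j _; rewrite mxE.
    by rewrite !ord1 eqxx.
  by rewrite mulr_gt0 ?ltr0n.
rewrite -[z]hsubmxK; move: (lsubmx z) (rsubmx z) => {z} a b.
rewrite diag_mx_row mul_row_block !mulmx0 addr0 add0r.
rewrite mul_row_block mulmx0 add0r tr_row_mx map_col_mx !mul_row_col.
pose al := a 0 0.
pose be := (b *m u) 0 0.
pose q := (b *m diag_mx d *m A *m b^t*) 0 0.
pose N := (b *m b^t*) 0 0.
have -> : ((a *m diag_mx t%:M *m x + b *m diag_mx (2%:R *: d) *m c) *m a^t*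
   + b *m diag_mx (2%:R *: d) *m A *m b^t*) 0 0
  = t * x 0 0 * (al * al^*) + be * al^* + 2%:R * q.
  rewrite -[b *m _ *m c]mulmxA -/u.
  rewrite linearZ /= -scalemxAr -!scalemxAl.
  rewrite !(entryD, mulmx11, entryJ) [X in _ + X]mxE -/q -/be.
  by rewrite !mxE eqxx !mulr1n -/al; ring.
have -> : (a *m a^t* + b *m b^t*) 0 0 = al * al^* + N.
  by rewrite entryD mulmx11 entryJ.
have qN_le0 : q + q^* + N <= 0 by exact: dA.
(* The square to be completed is the squared norm of b - a u^*. *)
have sq_ge0 : 0 <= N - be * al^* - be^* * al + K * (al * al^*).
  have := normmx_ge0 (b - a *m u^t*).
  have -> : ((b - a *m u^t*) *m (b - a *m u^t*)^t*) 0 0 =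
    N - be * al^* - be^* * al + K * (al * al^*); last by [].
  have -> : (b - a *m u^t*)^t* = b^t* - u *m a^t*.
    by rewrite linearB /= map_mxB adjoint_mulmx trmxCK.
  rewrite mulmxBl !mulmxBr.
  rewrite -[a *m _ *m b^t*]mulmxA -adjoint_mulmx [b *m (_ *m _)]mulmxA.
  rewrite -[a *m _ *m (_ *m _)]mulmxA [u^t* *m _]mulmxA.
  by rewrite !(entryD, entryN, entryJ, mulmx11) -/N -/K -/be -/al; ring.
have tx : t * (x 0 0 + (x 0 0)^*) = - (1 + K).
  by rewrite /t divfK // lt_eqF.
have t_real : t^* = t by apply/CrealP/gtr0_real.
clearbody t.
have -> : t * x 0 0 * (al * al^*) + be * al^* + 2 * q +
    (t * x 0 0 * (al * al^*) + be * al^* + 2 * q)^* + (al * al^* + N) =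
    2%:R * (q + q^* + N) - (N - be * al^* - be^* * al + K * (al * al^*)).
  rewrite !rmorphD !rmorphM /= !conjCK conjC_nat t_real.
  have -> : t * x 0 0 * (al * al^*) + be * al^* + 2 * q +
   (t * (x 0 0)^* * (al^* * al) + be^* * al + 2 * q^*) + (al * al^* + N) =
   t * (x 0 0 + (x 0 0)^*) * (al * al^*) + be * al^* + be^* * al +
   2 * (q + q^*) + al * al^* + N by ring.
  by rewrite tx; ring.
by rewrite subr_le0 (le_trans _ sq_ge0) // mulr_ge0_le0 ?ler0n.
Qed.

(** With M = U^* T U a Schur decomposition and D a diagonal Lyapunov matrix for
    T, the matrix U^* D U is one for M. *)
Lemma complex_lyapunov n (M : 'M[C]_n) :
    (forall z, eigenvalue M z -> z + z^* < 0) ->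
  exists P : 'M[C]_n, [/\ P^t* = P,
    forall z : 'rV_n, z != 0 -> 0 < (z *m P *m z^t*) 0 0 &
    forall z : 'rV_n, z != 0 ->
      let q := (z *m P *m M *m z^t*) 0 0 in q + q^* < 0].
Proof.
case: n M => [|n] M M_stable.
  by exists 0; split=> [|z|z]; rewrite ?thinmx0 ?eqxx //; apply/matrixP; case.
have [U U_unitary U_trig] := Schur M (ltn0Sn n).
have U_unit := unitarymx_unit U_unitary.
have [T TE T_conj] : exists2 T, T *m U = U *m M & T = conjmx U M.
  by exists (conjmx U M); rewrite ?conjumx ?mulmxKV.
have T_trig : is_trig_mx T by rewrite T_conj.
have T_stable i : T i i + (T i i)^* < 0.
  apply: M_stable; apply: (@eigenvalue_conjmx _ _ _ U).
  - by rewrite stablemx_unit.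
  - by rewrite row_free_unit.
  rewrite -T_conj [_ \in _]eigenvalue_root_char char_poly_trig //.
  rewrite -(big_map (fun j => T j j) xpredT (fun a => 'X - a%:P)).
  rewrite root_prod_XsubC.
  by apply/mapP; exists i; rewrite ?mem_index_enum.
have [d d_gt0 d_lyap] := trig_lyapunov T_trig T_stable.
exists (U^t* *m diag_mx d *m U).
have Uz0 (z : 'rV_n.+1) : z != 0 -> z *m U^t* != 0.
  by rewrite -invmx_unitary // mulmx_free_eq0 // row_free_unit unitmx_inv.
have zUt (z : 'rV_n.+1) : (z *m U^t*)^t* = U *m z^t*.
  by rewrite adjoint_mulmx trmxCK.
split=> [|z z0|z z0 /=].
- rewrite !adjoint_mulmx trmxCK mulmxA tr_diag_mx map_diag_mx.
  congr (_ *m diag_mx _ *m _); apply/rowP => i; rewrite mxE.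
  by apply/CrealP/gtr0_real.
- have := diag_form_gt0 d_gt0 (Uz0 z z0).
  by rewrite zUt !mulmxA.
have -> : z *m (U^t* *m diag_mx d *m U) *m M *m z^t* =
    z *m U^t* *m diag_mx d *m T *m (z *m U^t*)^t*.
  by rewrite zUt !mulmxA -(mulmxA _ T U) TE mulmxA.
have /= zU_lyap := d_lyap (z *m U^t*).
apply: lt_le_trans zU_lyap.
by rewrite ltrDl normmx_gt0 // Uz0.
Qed.

End ComplexLyapunov.

(** * Lyapunov's theorem for real matrices *)

Section RealMatrices.
Context {R : realType}.
Local Notation toC := (map_mx (real_complex R)).
Local Notation ReM := (map_mx (@complex.Re R)).
Local Notation ImM := (map_mx (@complex.Im R)).

Lemma addcJ_lt0 (z : R[i]) : (z + z^* < 0) = (complex.Re z < 0).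
Proof. by rewrite (addcJ z) pmulr_rlt0 ?ltr0n // (ltcR _ 0). Qed.

Lemma Re_mulmx_real m n p (A : 'M[R[i]]_(m, n)) (B : 'M[R]_(n, p)) :
  ReM (A *m toC B) = ReM A *m B.
Proof.
apply/matrixP=> i j; rewrite !mxE raddf_sum; apply: eq_bigr => k _.
by rewrite !mxE; case: (A i k) => a b /=; rewrite mulr0 subr0.
Qed.

Lemma Re_real_mulmx m n p (A : 'M[R]_(m, n)) (B : 'M[R[i]]_(n, p)) :
  ReM (toC A *m B) = A *m ReM B.
Proof.
apply/matrixP=> i j; rewrite !mxE raddf_sum; apply: eq_bigr => k _.
by rewrite !mxE; case: (B k j) => a b /=; rewrite mul0r subr0.
Qed.

Lemma adjoint_real m n (A : 'M[R]_(m, n)) : (toC A)^t* = toC A^T.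
Proof. by apply/matrixP=> i j; rewrite !mxE; exact: conjc_real. Qed.

(** The last condition says that P M + M^T P, which has twice the quadratic form
    of P M, is negative definite. *)
Definition lyapunov_matrix n (M P : 'M[R]_n) :=
  [/\ P^T = P,
    forall x : 'rV_n, x != 0 -> 0 < (x *m P *m x^T) 0 0 &
    forall x : 'rV_n, x != 0 -> (x *m P *m M *m x^T) 0 0 < 0].

(** For real [M] and real row vectors [x], taking real parts commutes with the
    products by [M] and by [x], so the real part of a complex Lyapunov matrix
    inherits its properties. *)
Lemma hurwitz_lyapunov n (M : 'M[R]_n) :
  hurwitz_stable M -> exists P, lyapunov_matrix M P.
Proof.
move=> M_stable.
have [z Mz|P [PJ P_gt0 P_lyap]] := @complex_lyapunov R[i] n (toC M).
  by rewrite addcJ_lt0 M_stable.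
have toC_neq0 (x : 'rV[R]_n) : x != 0 -> toC x != 0 by rewrite map_mx_eq0.
have ReE (E : 'M[R[i]]_1) : complex.Re (E 0 0) = (ReM E) 0 0 by rewrite mxE.
exists (ReM P); split=> [|x x0|x x0].
- apply/matrixP=> i j; rewrite -{1}PJ !mxE.
  by case: (P i j).
- have := P_gt0 _ (toC_neq0 x x0); rewrite adjoint_real ltcE => /andP[_].
  by rewrite ReE Re_mulmx_real Re_real_mulmx.
- have := P_lyap _ (toC_neq0 x x0); rewrite /= addcJ_lt0 adjoint_real.
  by rewrite ReE !Re_mulmx_real Re_real_mulmx.
Qed.

(** The cross terms between the real and imaginary parts of [w] are purely
    imaginary. *)
Lemma Re_form n (Q : 'M[R]_n) (w : 'rV[R[i]]_n) :
  complex.Re ((w *m toC Q *m w^t*) 0 0) =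
    (ReM w *m Q *m (ReM w)^T) 0 0 + (ImM w *m Q *m (ImM w)^T) 0 0.
Proof.
rewrite !mxE raddf_sum -big_split; apply: eq_bigr => j _ /=.
rewrite !mxE !big_distrl raddf_sum -big_split; apply: eq_bigr => k _ /=.
rewrite !mxE; case: (w 0 k) (w 0 j) => [a b] [c d] /=; ring.
Qed.

Lemma posdef_unit n (P : 'M[R]_n) :
  (forall x : 'rV_n, x != 0 -> 0 < (x *m P *m x^T) 0 0) -> P \in unitmx.
Proof.
move=> P_gt0; rewrite -row_free_unit -kermx_eq0.
apply/rowV0P => x /sub_kermxP xP; apply/eqP; apply: contraT => /P_gt0.
by rewrite xP mul0mx mxE ltxx.
Qed.

(** If z M = l z and z = w P, then w (P M) w^* = l w P w^*.  Here w P w^* is a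
    positive real because P is symmetric positive definite, and the left side
    has negative real part.  Substituting w P for z turns a row eigenvector of M
    into one to which the form of P M, rather than that of M P^-1, applies. *)
Lemma lyapunov_hurwitz n (M P : 'M[R]_n) :
  lyapunov_matrix M P -> hurwitz_stable M.
Proof.
move=> [P_sym P_gt0 P_lyap] l /eigenvalueP[z zM z0].
have P_unit := posdef_unit P_gt0.
have PC_unit : toC P \in unitmx by rewrite map_unitmx.
have [w w0 wP] : exists2 w, w != 0 & w *m toC P = z.
  exists (z *m invmx (toC P)); last by rewrite mulmxKV.
  by rewrite mulmx_free_eq0 // row_free_unit unitmx_inv.
pose s := (w *m toC P *m w^t*) 0 0.
have s_real : complex.Im s = 0.
  have : s^* = s.
    rewrite -entryJ !adjoint_mulmx trmxCK adjoint_real P_sym.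
    by rewrite mulmxA.
  case: (s) => a b [] /eqP.
  by rewrite -subr_eq0 -opprD oppr_eq0 -mulr2n mulrn_eq0 /= => /eqP.
have w_parts : ReM w != 0 \/ ImM w != 0.
  have [Rw0|] := eqVneq (ReM w) 0; last by left.
  right; apply: contra_neq w0 => Iw0; apply/matrixP=> i j; rewrite [RHS]mxE.
  move/matrixP/(_ i j): Rw0; move/matrixP/(_ i j): Iw0; rewrite !mxE.
  by case: (w i j) => a b /= -> ->.
have form_lt0 (Q : 'M[R]_n) :
    (forall x : 'rV_n, x != 0 -> (x *m Q *m x^T) 0 0 < 0) ->
  complex.Re ((w *m toC Q *m w^t*) 0 0) < 0.
  move=> Q_lt0.
  have Q_le0 (x : 'rV_n) : (x *m Q *m x^T) 0 0 <= 0.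
    have [->|x0] := eqVneq x 0; last by apply: ltW; exact: Q_lt0.
    by rewrite !mul0mx mxE.
  rewrite Re_form; case: w_parts => w_part0.
    by apply: ltr_wnDr; [exact: Q_le0 | exact: Q_lt0].
  by apply: ltr_wnDl; [exact: Q_le0 | exact: Q_lt0].
have s_gt0 : 0 < complex.Re s.
  have := form_lt0 (- P); rewrite map_mxN mulmxN mulNmx entryN raddfN oppr_lt0.
  by apply=> x /P_gt0; rewrite mulmxN mulNmx entryN oppr_lt0.
have : complex.Re (l * s) < 0.
  have -> : l * s = (w *m toC (P *m M) *m w^t*) 0 0.
    by rewrite map_mxM mulmxA wP zM -scalemxAl mxE /s wP.
  by apply: form_lt0 => x x0; rewrite mulmxA P_lyap.
move: s_real s_gt0; case: (s) => a b /= -> a_gt0; case: l {zM} => c d /=.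
by rewrite mulr0 subr0 pmulr_llt0.
Qed.

(** * Stability under similarity and block triangular extension *)

Lemma hurwitz_similar n (S A B : 'M[R]_n) :
  S \in unitmx -> S *m A = B *m S -> hurwitz_stable A -> hurwitz_stable B.
Proof.
move=> S_unit SA A_stable l /eigenvalueP[z zB z0]; apply: A_stable.
apply/eigenvalueP; exists (z *m toC S).
  by rewrite -mulmxA -map_mxM SA map_mxM mulmxA zB scalemxAl.
by rewrite mulmx_free_eq0 // row_free_unit map_unitmx.
Qed.

Lemma hurwitz_opp1 n : hurwitz_stable (- 1%:M : 'M[R]_n).
Proof.
move=> l /eigenvalueP[z]; rewrite map_mxN map_mx1 mulmxN mulmx1 -scaleN1r.
move=> /eqP; rewrite -subr_eq0 -scalerBl scaler_eq0 subr_eq0 => /orP[|->//].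
by move=> /eqP <- _ /=; rewrite oppr_lt0 ltr01.
Qed.

Lemma hurwitz_block_upper p q (X : 'M[R]_p) (Y : 'M[R]_(p, q)) (F : 'M[R]_q) :
  hurwitz_stable X -> hurwitz_stable F -> hurwitz_stable (block_mx X Y 0 F).
Proof.
move=> X_stable F_stable l /eigenvalueP[z].
rewrite -[z]hsubmxK; move: (lsubmx z) (rsubmx z) => {z} a b.
rewrite map_block_mx map_mx0 mul_row_block mulmx0 addr0 scale_row_mx.
move=> /eq_row_mx[aX bF]; rewrite row_mx_eq0 negb_and.
have [a0|a0 _] := eqVneq a 0; last by apply: X_stable; apply/eigenvalueP; exists a.
move=> b0; apply: F_stable; apply/eigenvalueP; exists b => //.
by rewrite -bF a0 mul0mx add0r.
Qed.

(** * The reduced-order observer *)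

(** A row vector supported on the last coordinates sees only the lower right
    blocks of P and of P M, and the gain is chosen so that the latter factors
    through the former. *)
Lemma lyapunov_corner p q (M P : 'M[R]_(p + q)) : lyapunov_matrix M P ->
  lyapunov_matrix
    (drsubmx M + invmx (drsubmx P) *m dlsubmx P *m ursubmx M) (drsubmx P).
Proof.
move=> [P_sym P_gt0 P_lyap].
have pad0 (x : 'rV[R]_q) : x != 0 -> row_mx (0 : 'rV_p) x != 0.
  by rewrite row_mx_eq0 eqxx.
have corner_form (Q : 'M[R]_(p + q)) (x : 'rV_q) :
    row_mx 0 x *m Q *m (row_mx 0 x)^T = x *m drsubmx Q *m x^T.
  rewrite -{1}[Q]submxK mul_row_block !mul0mx !add0r.
  by rewrite tr_row_mx mul_row_col trmx0 mulmx0 add0r.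
have corner_gt0 (x : 'rV_q) : x != 0 -> 0 < (x *m drsubmx P *m x^T) 0 0.
  by move=> /pad0/P_gt0; rewrite corner_form.
have corner_unit := posdef_unit corner_gt0.
split=> // [|x /pad0/P_lyap].
  by rewrite trmx_drsub P_sym.
have PM_corner : drsubmx (P *m M) =
    drsubmx P *m (drsubmx M + invmx (drsubmx P) *m dlsubmx P *m ursubmx M).
  rewrite -{1}[P]submxK -{1}[M]submxK mulmx_block block_mxKdr.
  by rewrite mulmxDr !mulmxA mulmxV // mul1mx addrC.
by rewrite -(mulmxA _ P M) corner_form PM_corner mulmxA.
Qed.

(** A stable M makes the pair of its lower right and upper right blocks
    detectable: this is how detectability descends to the unmeasured part of
    the state. *)
Lemma hurwitz_corner p q (M : 'M[R]_(p + q)) : hurwitz_stable M ->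
  exists L : 'M_(q, p), hurwitz_stable (drsubmx M + L *m ursubmx M).
Proof.
move=> /hurwitz_lyapunov[P MP].
exists (invmx (drsubmx P) *m dlsubmx P).
exact: lyapunov_hurwitz (lyapunov_corner MP).
Qed.

(** Gaussian elimination writes [C] as an invertible matrix times the first [p]
    rows of the invertible [row_ebase C]; the other rows complete it. *)
Lemma free_completion p q (C : 'M[R]_(p, p + q)) :
  row_free C -> exists T : 'M_(q, p + q), col_mx C T \in unitmx.
Proof.
move=> /eqP C_free; exists (dsubmx (row_ebase C)).
have -> : col_mx C (dsubmx (row_ebase C)) =
    block_mx (col_ebase C) 0 0 1%:M *m row_ebase C.
  rewrite -[X in _ = _ *m X]vsubmxK mul_block_col !mul0mx addr0 add0r mul1mx.
  congr col_mx; rewrite -[LHS]mulmx_ebase C_free pid_mx_row.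
  by rewrite -[X in _ *m X]vsubmxK -mulmxA mul_row_col mul1mx mul0mx addr0.
rewrite unitmx_mul row_ebase_unit andbT unitmxE det_ublock det1 mulr1 -unitmxE.
exact: col_ebase_unit.
Qed.

(** The gain replaces the first block column of S A S^-1, whose upper part is
    [lsubmx X] and whose lower part is [G], by [-1; 0]. *)
Lemma observer_detectable p q (A : 'M[R]_(p + q)) (C : 'M[R]_(p, p + q))
    (F : 'M[R]_q) (T : 'M[R]_(q, p + q)) (G : 'M[R]_(q, p)) :
    hurwitz_stable F -> T *m A - F *m T = G *m C -> col_mx C T \in unitmx ->
  detectable A C.
Proof.
move=> F_stable /eqP; rewrite subr_eq => /eqP TA; set S := col_mx C T => S_unit.
pose X := C *m A *m invmx S.
exists (invmx S *m col_mx (- 1%:M - lsubmx X) (- G)).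
have := hurwitz_block_upper (Y := rsubmx X) (@hurwitz_opp1 p) F_stable.
apply: (hurwitz_similar (S := invmx S)); first by rewrite unitmx_inv.
apply: (canRL (mulmxK S_unit)); rewrite -mulmxA; apply: (canLR (mulKmx S_unit)).
rewrite mulmxDr !mulmxA mulmxV // mul1mx /S !mul_col_mx TA.
have -> : C *m A = lsubmx X *m C + rsubmx X *m T.
  by rewrite -mul_row_col hsubmxK mulmxKV.
rewrite !mul_row_col add_col_mx mul0mx add0r mulmxBl !mulNmx mul1mx.
congr col_mx; last by rewrite addrAC subrr add0r.
by rewrite [X in _ = _ + X]addrC addrACA subrr add0r addrC.
Qed.

(** In the coordinates of S, T is [L 1] and T B - F T has zero second block by
    the choice of F, so it is a multiple of C = [1 0]. *)
Lemma detectable_observer p q (A : 'M[R]_(p + q)) (C : 'M[R]_(p, p + q)) :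
    row_free C -> detectable A C ->
  exists (F : 'M[R]_q) (T : 'M[R]_(q, p + q)) (G : 'M[R]_(q, p)),
    [/\ hurwitz_stable F, T *m A - F *m T = G *m C & col_mx C T \in unitmx].
Proof.
move=> C_free [K K_stable]; have [T0] := free_completion C_free.
set S := col_mx C T0 => S_unit; pose B := S *m A *m invmx S.
have SA : S *m A = B *m S by rewrite mulmxKV.
have C_S : C = row_mx 1%:M 0 *m S by rewrite mul_row_col mul1mx mul0mx addr0.
clearbody S.
have : hurwitz_stable (B + row_mx (S *m K) 0).
  apply: hurwitz_similar S_unit _ K_stable.
  by rewrite mulmxDr SA mulmxDl mulmxA {1}C_S mulmxA mul_mx_row mulmx1 mulmx0.
move=> /hurwitz_corner[L].
have -> : drsubmx (B + row_mx (S *m K) 0) = drsubmx B.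
  by apply/matrixP => i j; rewrite !mxE (unsplitK (inr _)) mxE addr0.
have -> : ursubmx (B + row_mx (S *m K) 0) = ursubmx B.
  by apply/matrixP => i j; rewrite !mxE (unsplitK (inr _)) mxE addr0.
set F := _ + _ => F_stable.
exists F, (row_mx L 1%:M *m S), (L *m ulsubmx B + dlsubmx B - F *m L).
split=> //.
  rewrite -mulmxA SA mulmxA -{1}[B]submxK mul_row_block !mul1mx mulmxA.
  rewrite [L *m _ + drsubmx B]addrC -/F mul_mx_row mulmx1 -mulmxBl.
  by rewrite opp_row_mx add_row_mx subrr C_S mulmxA mul_mx_row mulmx1 mulmx0.
have -> : col_mx C (row_mx L 1%:M *m S) = block_mx 1%:M 0 L 1%:M *m S.
  by rewrite {1}C_S -mul_col_mx.
by rewrite unitmx_mul S_unit unitmxE det_lblock !det1 mulr1 unitr1.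
Qed.

(** With [n] a variable rather than [p + (n - p)], the cast in the square
    matrix [C; T] is removed by elimination of the equation [e]. *)
Lemma observer_iff n p q (e : (p + q = n)%N) (A : 'M[R]_n) (C : 'M[R]_(p, n)) :
  row_free C ->
  (exists (F : 'M[R]_q) (T : 'M[R]_(q, n)) (G : 'M[R]_(q, p)),
      hurwitz_stable F /\ row_free T /\
      T *m A - F *m T = G *m C /\
      \det (castmx (e, erefl n) (col_mx C T)) != 0)
  <-> detectable A C.
Proof.
case: n / e A C => A C C_free; split.
  move=> [F [T [G [F_stable [_ [TA]]]]]].
  rewrite castmx_id -unitfE -unitmxE; exact: observer_detectable F_stable TA.
move=> /(detectable_observer C_free)[F [T [G [F_stable TA CT_unit]]]].
exists F, T, G; rewrite castmx_id -unitfE -unitmxE; split=> //; split=> //.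
rewrite -kermx_eq0; apply/rowV0P => x /sub_kermxP xT.
have : row_mx (0 : 'rV_p) x *m col_mx C T = 0 by rewrite mul_row_col mul0mx xT addr0.
move/(canRL (mulmxK CT_unit)); rewrite mul0mx => /eqP.
by rewrite row_mx_eq0 => /andP[_ /eqP].
Qed.

End RealMatrices.

Theorem theorem1 (R : realType) (n p : nat) (A : 'M[R]_n) (C : 'M[R]_(p, n))
    (rkC : \rank C = p) :
  (exists (F : 'M[R]_(n - p)) (T : 'M[R]_(n - p, n)) (G : 'M[R]_(n - p, p)),
      hurwitz_stable F /\ row_free T /\
      T *m A - F *m T = G *m C /\
      \det (stack rkC T) != 0)
  <-> detectable A C.
Proof. by apply: observer_iff; apply/eqP. Qed.
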